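(* For any binary linear code $\mathcal{C}\subseteq\mathbb{F}_2^{2n}$, the 2-level Construction $C^\star$ defined as $$\Gamma_{C^\star}=\{c_1+2c_2+4z:(c_1,c_2)\in\mathcal{C},\ z\in\mathbb{Z}^n\}\subset\mathbb{R}^n$$ is geometrically uniform.
   Context: A codeword of $\mathcal{C}\subseteq\mathbb{F}_2^{2n}$ is written as $(c_1,c_2)$ with $c_1,c_2\in\mathbb{F}_2^n$ (its first $n$ and last $n$ coordinates); $c_1,c_2$ are regarded as vectors in $\{0,1\}^n\subset\mathbb{R}^n$ and the sum $c_1+2c_2+4z$ is a real sum. A binary linear code is a linear subspace over $\mathbb{F}_2$. A constellation (discrete set of points) $\Gamma\subset\mathbb{R}^n$ is geometrically uniform if for any two elements $c,c'\in\Gamma$ there exists a distance-preserving transformation $T:\mathbb{R}^n\to\mathbb{R}^n$ such that $c'=T(c)$ and $T(\Gamma)=\Gamma$. *)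

(* Defs.v *)
From HB Require Import structures.
From mathcomp Require Export all_boot all_order all_algebra.
From mathcomp Require Export all_classical all_reals all_analysis.
Export numFieldNormedType.Exports.
Set Implicit Arguments.
Unset Strict Implicit.
Unset Printing Implicit Defensive.
Import Order.TTheory GRing.Theory Num.Theory.
Local Open Scope classical_set_scope.
Local Open Scope ring_scope.

(* The library norm on row vectors is the sup norm, hence an explicit
   Euclidean distance.  Both induce the canonical topology of 'rV[R]_n. *)
Definition eucl_dist (R : realType) (n : nat) (x y : 'rV[R]_n) : R :=
  Num.sqrt (\sum_(i < n) (x ord0 i - y ord0 i) ^+ 2).

Definition distance_preserving (R : realType) (n : nat)
    (T : 'rV[R]_n -> 'rV[R]_n) : Prop :=
  forall x y, eucl_dist (T x) (T y) = eucl_dist x y.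

Definition constellation (R : realType) (n : nat) (G : set 'rV[R]_n) : Prop :=
  G `<=` isolated G.

(* Only constellations can be geometrically uniform, so discreteness is part
   of the notion. *)
Definition geometrically_uniform (R : realType) (n : nat)
    (G : set 'rV[R]_n) : Prop :=
  constellation G /\
  forall c c' : 'rV[R]_n, G c -> G c' ->
    exists T : 'rV[R]_n -> 'rV[R]_n,
      [/\ distance_preserving T, c' = T c & T @` G = G].

(* An element of 'F_2 coerces to the natural number 0 or 1, which is then
   cast into R; no reduction modulo 2 takes place afterwards. *)
Definition bits_to_real (R : realType) (n : nat) (b : 'rV['F_2]_n) : 'rV[R]_n :=
  map_mx (fun a : 'F_2 => (nat_of_ord a)%:R) b.

Definition construction_Cstar2 (R : realType) (n : nat)
    (C : {vspace 'rV['F_2]_(n + n)}) : set 'rV[R]_n :=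
  [set x | exists (c1 c2 : 'rV['F_2]_n) (z : 'rV[int]_n),
     row_mx c1 c2 \in C /\
     x = bits_to_real R c1 + 2%:R *: bits_to_real R c2
         + 4%:R *: map_mx intr z].

Arguments construction_Cstar2 R {n} C.

(* Main.v *)
(* Level-wise, adding a fixed pair of bits to (c_1i, c_2i) acts on the residue
   c_1i + 2 c_2i modulo 4 either as a translation or as a reflection of Z/4.
   Hence adding the difference of the two codewords lifts to a coordinatewise
   isometry x |-> c' + (+-1)(x - c), whose inverse is obtained by exchanging
   c and c'. *)
Require Import Defs.
From mathcomp Require Import ring.
Set Implicit Arguments.
Unset Strict Implicit.
Unset Printing Implicit Defensive.
Import Order.TTheory GRing.Theory Num.Theory.
Local Open Scope classical_set_scope.
Local Open Scope ring_scope.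

(** Valued in [int] rather than [R], so that identities modulo 4 can be settled by computation and
    [ring], and discreteness follows from integrality. *)
Definition Cstar_coord (a b : 'F_2) (z : int) : int :=
  (a : nat)%:Z + 2 * (b : nat)%:Z + 4 * z.

Lemma Cstar_coordP (R : realType) (n : nat) (C : {vspace 'rV['F_2]_(n + n)})
    (x : 'rV[R]_n) :
  construction_Cstar2 R C x <->
  exists (c1 c2 : 'rV['F_2]_n) (z : 'rV[int]_n), row_mx c1 c2 \in C /\
    forall i, x ord0 i = (Cstar_coord (c1 ord0 i) (c2 ord0 i) (z ord0 i))%:~R.
Proof.
have E c1 c2 (z : 'rV[int]_n) i :
    (bits_to_real R c1 + 2%:R *: bits_to_real R c2
       + 4%:R *: map_mx intr z) ord0 i
    = (Cstar_coord (c1 ord0 i) (c2 ord0 i) (z ord0 i))%:~R.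
  by rewrite !mxE /Cstar_coord !rmorphD !rmorphM.
split=> -[c1 [c2 [z [Cc xE]]]]; exists c1, c2, z; split=> //.
  by move=> i; rewrite xE E.
by apply/rowP => i; rewrite xE E.
Qed.

Lemma F2P (a : 'F_2) : a = 0 \/ a = 1.
Proof. by case: a => -[|[|//]] ai; [left|right]; apply: val_inj. Qed.

(* Adding the bits (e, f) is x |-> x + 2 f modulo 4 if e = 0, and
   x |-> 1 + 2 f - x modulo 4 if e = 1: a translation or a reflection. *)
Lemma Cstar_coord_flip (a1 a2 b1 b2 x1 x2 : 'F_2) (za zb zx : int) :
  exists z : int,
    Cstar_coord b1 b2 zb + (-1) ^+ (a1 + b1)%R
      * (Cstar_coord x1 x2 zx - Cstar_coord a1 a2 za)
    = Cstar_coord (a1 + b1 + x1) (a2 + b2 + x2) z.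
Proof.
set s : int := (-1) ^+ _.
(* With the multiples of 4 removed only six bits remain: 64 cases, in each of which the two sides
   differ by a multiple of 4, so the integer quotient is an exact witness. *)
have [k kE] : exists k : int,
    Cstar_coord b1 b2 0 + s * (Cstar_coord x1 x2 0 - Cstar_coord a1 a2 0)
    = Cstar_coord (a1 + b1 + x1) (a2 + b2 + x2) k.
  exists ((Cstar_coord b1 b2 0 + s * (Cstar_coord x1 x2 0 - Cstar_coord a1 a2 0)
    - Cstar_coord (a1 + b1 + x1) (a2 + b2 + x2) 0) %/ 4)%Z.
  rewrite /s; case: (F2P a1) => ->; case: (F2P a2) => ->; case: (F2P b1) => ->;
  by case: (F2P b2) => ->; case: (F2P x1) => ->; case: (F2P x2) => ->.
exists (k + zb + s * (zx - za)).
transitivity (Cstar_coord (a1 + b1 + x1) (a2 + b2 + x2) k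
  + 4 * (zb + s * (zx - za))); last by rewrite /Cstar_coord; ring.
by rewrite -kE /Cstar_coord; ring.
Qed.

(** Used with [e] the sum of the first-level parts of the two codewords: the reflected coordinates
    are those where these bits differ. *)
Definition flip (R : realType) (n : nat) (e : 'rV['F_2]_n) (c c' x : 'rV[R]_n) :
    'rV[R]_n :=
  \row_i (c' ord0 i + (-1) ^+ e ord0 i * (x ord0 i - c ord0 i)).

Lemma flip_distance_preserving (R : realType) (n : nat) (e : 'rV['F_2]_n)
  (c c' : 'rV[R]_n) : distance_preserving (flip e c c').
Proof.
move=> x y; rewrite /eucl_dist; congr Num.sqrt; apply: eq_bigr => i _.
rewrite !mxE opprD addrACA subrr add0r -mulrBr opprB addrA subrK.
by rewrite exprMn sqrr_sign mul1r.
Qed.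

Lemma flip_base (R : realType) (n : nat) (e : 'rV['F_2]_n)
  (c c' : 'rV[R]_n) : flip e c c' c = c'.
Proof. by apply/rowP => i; rewrite !mxE subrr mulr0 addr0. Qed.

Lemma flipK (R : realType) (n : nat) (e : 'rV['F_2]_n)
  (c c' : 'rV[R]_n) : cancel (flip e c' c) (flip e c c').
Proof.
move=> x; apply/rowP => i; rewrite !mxE [c _ _ + _]addrC addrK.
by rewrite signrMK addrC subrK.
Qed.

(** All points have integer coordinates, so an open sup-norm ball of radius 1 around one of them
    contains no other. *)
Lemma isolated_Cstar (R : realType) (n : nat)
  (C : {vspace 'rV['F_2]_(n + n)}) : constellation (construction_Cstar2 R C).
Proof.
move=> x Gx; split; first by rewrite inE.
exists (ball x 1); first exact: nbhsx_ballx.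
apply/seteqP; split=> [y [xy Gy]|_ ->]; last by split => //; exact: ballxx.
have [c1 [c2 [z [_ xE]]]] := (Cstar_coordP C x).1 Gx.
have [d1 [d2 [w [_ yE]]]] := (Cstar_coordP C y).1 Gy.
apply/rowP => i; have := xy.2 ord0 i.
rewrite -ball_normE /= xE yE -intrB -intr_norm -[1]/(1%:~R).
by rewrite ltr_int -[1]add0r ltzD1 normr_le0 subr_eq0 => /eqP ->.
Qed.

(** The image of a point with codeword [x] has codeword [a + b + x], which lies in [C] by
    linearity. *)
Lemma flip_Cstar (R : realType) (n : nat) (C : {vspace 'rV['F_2]_(n + n)})
    (a1 a2 b1 b2 : 'rV['F_2]_n) (za zb : 'rV[int]_n) (c c' x : 'rV[R]_n) :
  row_mx a1 a2 \in C -> row_mx b1 b2 \in C ->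
  (forall i, c ord0 i
    = (Cstar_coord (a1 ord0 i) (a2 ord0 i) (za ord0 i))%:~R) ->
  (forall i, c' ord0 i
    = (Cstar_coord (b1 ord0 i) (b2 ord0 i) (zb ord0 i))%:~R) ->
  construction_Cstar2 R C x -> construction_Cstar2 R C (flip (a1 + b1) c c' x).
Proof.
move=> Ca Cb cE c'E /Cstar_coordP[x1 [x2 [zx [Cx xE]]]]; apply/Cstar_coordP.
have [z zE] := choice (fun i => Cstar_coord_flip (a1 ord0 i) (a2 ord0 i)
  (b1 ord0 i) (b2 ord0 i) (x1 ord0 i) (x2 ord0 i)
  (za ord0 i) (zb ord0 i) (zx ord0 i)).
exists (a1 + b1 + x1), (a2 + b2 + x2), (\row_i z i); split.
  by rewrite -!add_row_mx !rpredD.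
move=> i; rewrite !mxE cE c'E xE -zE.
by rewrite intrD intrM rmorphXn rmorphN1 intrB.
Qed.

Theorem theorem3 (R : realType) (n : nat) (C : {vspace 'rV['F_2]_(n + n)}) :
  geometrically_uniform (construction_Cstar2 R C).
Proof.
split; first exact: isolated_Cstar.
move=> c c' Gc Gc'.
have [a1 [a2 [za [Ca cE]]]] := (Cstar_coordP C c).1 Gc.
have [b1 [b2 [zb [Cb c'E]]]] := (Cstar_coordP C c').1 Gc'.
exists (flip (a1 + b1) c c'); split.
- exact: flip_distance_preserving.
- by rewrite flip_base.
- apply/seteqP; split=> [_ [x Gx <-]|x Gx]; first exact: flip_Cstar Ca Cb cE c'E Gx.
  (* Surjectivity: the preimage is given by the inverse flip, which preserves the constellation by
     the same lemma with the two codewords exchanged, as [a1 + b1] is symmetric. *)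
  exists (flip (a1 + b1) c' c x); last exact: flipK.
  by rewrite addrC; exact: flip_Cstar Cb Ca c'E cE Gx.
Qed.
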